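(* Consider the continuous-time LQR problem with data $A\in\mathbb{R}^{m\times m}$, $B\in\mathbb{R}^{m\times r}$, and block diagonal symmetric positive definite $Q\in\mathbb{R}^{m\times m}$, $R\in\mathbb{R}^{r\times r}$, decomposed into $n$ subsystems. Let $F^0\in\mathbb{R}^{r\times m}$ be an arbitrary initial guess, let $i\in\{1,\dots,n\}$ be arbitrary, and let $(F^k)_{k\ge 0}$ be the iterates of the split optimal policy iteration started with $F^0$ and updating the $i$-th subsystem first. If the pair $(A^{(i)}(F^0),B^{(i)})$ is controllable, then: (i) all iterates $F^k$, $k\ge 1$, stabilize the global system, i.e. all eigenvalues of $A+BF^k$ have negative real part; (ii) the value functions $V^k$ corresponding to the $F^k$ satisfy $V^{k+1}(x)\le V^k(x)$ for all $x\in\mathbb{R}^m$ and all $k\ge 0$; (iii) $F^k\to F^{\mathrm{opt}}$ as $k\to\infty$, where $F^{\mathrm{opt}}$ is the optimal feedback matrix of the original problem.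
   Context: Continuous-time LQR problem: the system is $\dot x(t)=Ax(t)+Bu(t)$ with accumulated cost $\int_0^\infty x(t)^{T}Qx(t)+u(t)^{T}Ru(t)\,dt$ to be minimized. The optimal feedback is $u=F^{\mathrm{opt}}x$ with $F^{\mathrm{opt}}=-R^{-1}B^{T}P^{\mathrm{opt}}$, where $P^{\mathrm{opt}}$ is the unique symmetric positive definite solution of $A^{T}P+PA-PBR^{-1}B^{T}P+Q=0$. Subsystems: the inputs are partitioned as $r=r_1+\dots+r_n$ and the states as $m=m_1+\dots+m_n$; $R$ is block diagonal with blocks of sizes $r_1,\dots,r_n$ and $Q$ is block diagonal with blocks of sizes $m_1,\dots,m_n$. For $i=1,\dots,n$, $\Pi_i\in\mathbb{R}^{r\times r_i}$ is the block column matrix whose $i$-th block is the identity and whose other blocks are $0$. For $F\in\mathbb{R}^{r\times m}$ put $$A^{(i)}(F)=A+B(I-\Pi_i\Pi_i^{T})F,\quad B^{(i)}=B\Pi_i,$$ $$Q^{(i)}(F)=Q+F^{T}(I-\Pi_i\Pi_i^{T})R(I-\Pi_i\Pi_i^{T})F,\quad R^{(i)}=\Pi_i^{T}R\Pi_i .$$ Update of subsystem $i$: given $F$, let $P^{\mathrm{new}}$ be the unique symmetric positive definite solution of the Riccati equation above with $(A,B,Q,R)$ replaced by $(A^{(i)}(F),B^{(i)},Q^{(i)}(F),R^{(i)})$. The updated matrix $g^i(F)=F^{\mathrm{new}}$ is defined by $\Pi_i^{T}F^{\mathrm{new}}=-(R^{(i)})^{-1}(B^{(i)})^{T}P^{\mathrm{new}}$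 and $(I-\Pi_i\Pi_i^{T})F^{\mathrm{new}}=(I-\Pi_i\Pi_i^{T})F$. Split optimal policy iteration started at $F^0$ with subsystem $i$ first: $F^{k+1}=g^{i_k}(F^k)$ for $k\ge 0$, where $i_0=i$ and the indices sweep cyclically through the subsystems ($i_{k+1}=i_k+1$ if $i_k<n$, and $i_{k+1}=1$ if $i_k=n$). Value function: $V^k(x)\in[0,\infty]$ is the cost $\int_0^\infty x(t)^{T}Qx(t)+u(t)^{T}Ru(t)\,dt$ along the solution of $\dot x=(A+BF^k)x$, $x(0)=x$, with $u(t)=F^kx(t)$. *)

(* Defs.v *)
From HB Require Import structures.
From mathcomp Require Import all_boot all_order all_algebra complex.
From mathcomp Require Import all_classical all_reals all_analysis.

Set Implicit Arguments.
Unset Strict Implicit.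
Unset Printing Implicit Defensive.

Import Order.TTheory GRing.Theory Num.Theory numFieldNormedType.Exports.

Local Open Scope classical_set_scope.
Local Open Scope ring_scope.

Definition qform (K : realType) m (M : 'M[K]_m) (v : 'cV[K]_m) : K :=
  (v^T *m M *m v) 0 0.

Definition sym_posdef (K : realType) m (M : 'M[K]_m) : Prop :=
  M^T = M /\ forall v : 'cV[K]_m, v != 0 -> 0 < qform M v.

Definition block_diag (K : realType) n (d : 'I_n -> nat)
    (M : 'M[K]_(\sum_j d j)) : Prop :=
  exists D : forall j : 'I_n, 'M[K]_(d j), M = \mxdiag_j D j.

(* The eigenvalues of a real matrix are taken in the complex numbers. *)
Definition stable (K : realType) m (M : 'M[K]_m) : Prop :=
  forall l : complex K,
    eigenvalue (map_mx (real_complex K) M) l -> complex.Re l < 0.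

(* [x] solves [x' = A x + B u] on the interval [J]; the equation is required in
   the interior of [J], and continuity on [J] takes care of the end points. *)
Definition trajectory (K : realType) m r (A : 'M[K]_m) (B : 'M[K]_(m, r))
    (J : interval K) (u : K -> 'cV[K]_r) (x : K -> 'cV[K]_m) : Prop :=
  {within [set` J], continuous x} /\
  forall t : K, [set` J]° t -> is_derive t (1 : K) x (A *m x t + B *m u t).

(* Controllability by steering: any state can be driven to any other state in
   finite time. Restricting the inputs to continuous ones loses no generality:
   it yields the same controllable pairs as larger input classes. *)
Definition controllable (K : realType) m r (A : 'M[K]_m) (B : 'M[K]_(m, r)) :
    Prop :=
  forall x0 x1 : 'cV[K]_m, exists (T : K) (u : K -> 'cV[K]_r) (x : K -> 'cV[K]_m),
    [/\ 0 < T, {within `[0, T], continuous u},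
        trajectory A B `[0, T] u x, x 0 = x0 & x T = x1].

(* The integrand is nonnegative in all uses, so that this Lebesgue integral is
   a well-defined element of [0, +oo]. *)
Definition cost (K : realType) m r (Q : 'M[K]_m) (R : 'M[K]_r)
    (x : K -> 'cV[K]_m) (u : K -> 'cV[K]_r) : \bar K :=
  (\int[lebesgue_measure]_(t in `[0%R, +oo[) (qform Q (x t) + qform R (u t))%:E)%E.

(* The solution of [x' = (A + B F) x], [x 0 = x0]; it exists and is unique on
   [0, +oo[ (its values at negative times are irrelevant). *)
Definition closed_loop (K : realType) m r (A : 'M[K]_m) (B : 'M[K]_(m, r))
    (F : 'M[K]_(r, m)) (x0 : 'cV[K]_m) : K -> 'cV[K]_m :=
  get [set x | trajectory A B `[0, +oo[ (fun t => F *m x t) x /\ x 0 = x0].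

Definition value (K : realType) m r (A : 'M[K]_m) (B : 'M[K]_(m, r))
    (Q : 'M[K]_m) (R : 'M[K]_r) (F : 'M[K]_(r, m)) (x0 : 'cV[K]_m) : \bar K :=
  let x := closed_loop A B F x0 in cost Q R x (fun t => F *m x t).

Definition riccati_sol (K : realType) m r (A : 'M[K]_m) (B : 'M[K]_(m, r))
    (Q : 'M[K]_m) (R : 'M[K]_r) (P : 'M[K]_m) : Prop :=
  sym_posdef P /\
  A^T *m P + P *m A - P *m B *m invmx R *m B^T *m P + Q = 0.

(* Meaningful only when [riccati_sol A B Q R] has a unique solution. *)
Definition riccati (K : realType) m r (A : 'M[K]_m) (B : 'M[K]_(m, r))
    (Q : 'M[K]_m) (R : 'M[K]_r) : 'M[K]_m :=
  get [set P | riccati_sol A B Q R P].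

Definition lqr_gain (K : realType) m r (A : 'M[K]_m) (B : 'M[K]_(m, r))
    (Q : 'M[K]_m) (R : 'M[K]_r) : 'M[K]_(r, m) :=
  - (invmx R *m B^T *m riccati A B Q R).

(* The [i]-th block column of the identity matrix; see [Pi_block]. *)
Definition Pi (K : realType) n (r_ : 'I_n -> nat) (i : 'I_n) :
    'M[K]_(\sum_j r_ j, r_ i) :=
  submxrow (1%:M : 'M[K]_(\sum_j r_ j)) i.
Arguments Pi K {n} r_ i.

Definition coPi (K : realType) n (r_ : 'I_n -> nat) (i : 'I_n) :
    'M[K]_(\sum_j r_ j) :=
  1%:M - Pi K r_ i *m (Pi K r_ i)^T.
Arguments coPi K {n} r_ i.

Definition subA (K : realType) n m (r_ : 'I_n -> nat) (A : 'M[K]_m)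
    (B : 'M[K]_(m, \sum_j r_ j)) (i : 'I_n) (F : 'M[K]_(\sum_j r_ j, m)) :
    'M[K]_m :=
  A + B *m coPi K r_ i *m F.

Definition subB (K : realType) n m (r_ : 'I_n -> nat)
    (B : 'M[K]_(m, \sum_j r_ j)) (i : 'I_n) : 'M[K]_(m, r_ i) :=
  B *m Pi K r_ i.

Definition subQ (K : realType) n m (r_ : 'I_n -> nat) (Q : 'M[K]_m)
    (R : 'M[K]_(\sum_j r_ j)) (i : 'I_n) (F : 'M[K]_(\sum_j r_ j, m)) :
    'M[K]_m :=
  Q + F^T *m coPi K r_ i *m R *m coPi K r_ i *m F.

Definition subR (K : realType) n (r_ : 'I_n -> nat)
    (R : 'M[K]_(\sum_j r_ j)) (i : 'I_n) : 'M[K]_(r_ i) :=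
  (Pi K r_ i)^T *m R *m Pi K r_ i.

Definition sub_riccati_sol (K : realType) n m (r_ : 'I_n -> nat) (A : 'M[K]_m)
    (B : 'M[K]_(m, \sum_j r_ j)) (Q : 'M[K]_m) (R : 'M[K]_(\sum_j r_ j))
    (i : 'I_n) (F : 'M[K]_(\sum_j r_ j, m)) (P : 'M[K]_m) : Prop :=
  riccati_sol (subA A B i F) (subB B i) (subQ Q R i F) (subR R i) P.

Definition sub_gain (K : realType) n m (r_ : 'I_n -> nat) (A : 'M[K]_m)
    (B : 'M[K]_(m, \sum_j r_ j)) (Q : 'M[K]_m) (R : 'M[K]_(\sum_j r_ j))
    (i : 'I_n) (F : 'M[K]_(\sum_j r_ j, m)) : 'M[K]_(r_ i, m) :=
  lqr_gain (subA A B i F) (subB B i) (subQ Q R i F) (subR R i).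

(* The matrix whose [i]-th block row is the new gain and whose other block rows
   are those of [F]; see [updateP]. *)
Definition update (K : realType) n m (r_ : 'I_n -> nat) (A : 'M[K]_m)
    (B : 'M[K]_(m, \sum_j r_ j)) (Q : 'M[K]_m) (R : 'M[K]_(\sum_j r_ j))
    (i : 'I_n) (F : 'M[K]_(\sum_j r_ j, m)) : 'M[K]_(\sum_j r_ j, m) :=
  Pi K r_ i *m sub_gain A B Q R i F + coPi K r_ i *m F.

Lemma Pi_block (K : realType) n (r_ : 'I_n -> nat) (i : 'I_n) :
  submxcol (Pi K r_ i) i = 1%:M /\
  forall j, j != i -> submxcol (Pi K r_ i) j = 0.
Proof.
split=> [|j ji].
  rewrite /Pi -submxblockEh -mxdiagZ submxblock_diag; reflexivity.
rewrite /Pi -submxblockEh -mxdiagZ /mxdiag mxblockK (negbTE ji) //.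
Qed.

Lemma trPi_Pi (K : realType) n (r_ : 'I_n -> nat) (i : 'I_n) :
  (Pi K r_ i)^T *m Pi K r_ i = 1%:M.
Proof.
by rewrite {2}/Pi mul_submxrow mulmx1 -tr_submxcol (Pi_block K r_ i).1 trmx1.
Qed.

Lemma updateP (K : realType) n m (r_ : 'I_n -> nat) (A : 'M[K]_m)
    (B : 'M[K]_(m, \sum_j r_ j)) (Q : 'M[K]_m) (R : 'M[K]_(\sum_j r_ j))
    (i : 'I_n) (F G : 'M[K]_(\sum_j r_ j, m)) :
  G = update A B Q R i F <->
  (Pi K r_ i)^T *m G = sub_gain A B Q R i F /\
  coPi K r_ i *m G = coPi K r_ i *m F.
Proof.
have PcP : (Pi K r_ i)^T *m coPi K r_ i = 0.
  by rewrite mulmxBr mulmx1 mulmxA trPi_Pi mul1mx subrr.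
have cPP : coPi K r_ i *m Pi K r_ i = 0.
  by rewrite mulmxBl mul1mx -mulmxA trPi_Pi mulmx1 subrr.
have cP2 : coPi K r_ i *m coPi K r_ i = coPi K r_ i.
  by rewrite {2}/coPi mulmxBr mulmx1 mulmxA cPP mul0mx subr0.
split=> [->|[G1 G2]].
  rewrite /update; split; rewrite mulmxDr !mulmxA.
    by rewrite trPi_Pi PcP mul1mx mul0mx addr0.
  by rewrite cPP cP2 mul0mx add0r.
by rewrite /update -G1 -G2 mulmxA -mulmxDl /coPi addrC subrK mul1mx.
Qed.

(* Subsystems are numbered from [0]; [ordS] is the cyclic successor. *)
Definition sweep n (i : 'I_n) (k : nat) : 'I_n := iter k (@ordS n) i.

Fixpoint split_opi (K : realType) n m (r_ : 'I_n -> nat) (A : 'M[K]_m)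
    (B : 'M[K]_(m, \sum_j r_ j)) (Q : 'M[K]_m) (R : 'M[K]_(\sum_j r_ j))
    (F0 : 'M[K]_(\sum_j r_ j, m)) (i : 'I_n) (k : nat) :
    'M[K]_(\sum_j r_ j, m) :=
  if k is k'.+1 then update A B Q R (sweep i k') (split_opi A B Q R F0 i k')
  else F0.

(* Main.v *)
Require Import Defs.
From HB Require Import structures.
From mathcomp Require Import all_boot all_order all_algebra complex.
From mathcomp Require Import all_classical all_reals all_analysis.
From mathcomp Require Import ring lra zify measurable_realfun.
Import Order.TTheory GRing.Theory Num.Theory numFieldNormedType.Exports.
Local Open Scope classical_set_scope.
Local Open Scope ring_scope.

(** Stability is handled through Lyapunov forms throughout. For a feedback [F] and
    a quadratic form [P], let [resid A B Q R F P] be the running cost under [F]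
    plus the derivative of [P] along the closed loop. Completing the square
    ([resid_gain]) shows that the residual is the left-hand side of the Riccati
    equation plus the square of [F - gain B R P] in the norm of [R]. A solution of
    the equation therefore has a nonnegative residual at every feedback, and
    residual [0] at its own gain.

    As [R] is block diagonal, the subproblem of block [i] at [F] is the global
    problem in which only block row [i] of the feedback may change ([sub_resid]).
    Hence the solution [P k] of the [k]-th subproblem has residual [0] at
    [F k.+1] and a nonnegative one at [F k] ([split_step]). Three consequences:

    - Since [Q] is positive definite, [P k] is a Lyapunov form of the closed loop
      of [F k.+1], which is thus stable ([resid_lyap_stable],
      [lyap_stable_stable]).

    - Integrating along trajectories, [P k] is at least the value function of
      [F k.+1] and at most that of [F k] ([value_le], [value_ge]). The second
      bound needs no stability: a trajectory of finite cost comes arbitrarily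
      close to the origin because [Q] is positive definite.

    - A form that decreases along a stable system is nonnegative
      ([lyap_compare]), so [P k.+1] lies below [P k] and the [P k] converge. The
      sweep visits every block infinitely often, so [F k] converges to the gain
      of the limit; passing to the limit in [resid A B Q R (F k.+1) (P k) = 0]
      shows that the limit solves the global Riccati equation
      ([policy_limit]), whose solution is unique, again by comparison.

    What remains is solvability. A Riccati equation with a stabilizing feedback
    is solved by policy iteration ([riccati_exists]), by the same monotone
    convergence. For the subproblems after the first, the current iterate
    provides such a feedback ([split_stabilizable]); for the first one it comes
    from controllability ([controllable_stabilizable]). *)

(** * Quadratic forms *)

Section Transpose.
Context {K : realType} {m n : nat}.
Implicit Types M X : 'M[K]_(m, n).

Lemma trmxD M X : (M + X)^T = M^T + X^T.
Proof. exact: linearD. Qed.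

Lemma trmxN M : (- M)^T = - M^T.
Proof. exact: linearN. Qed.

Lemma trmxB M X : (M - X)^T = M^T - X^T.
Proof. exact: linearB. Qed.

Lemma trmxZ c M : (c *: M)^T = c *: M^T.
Proof. exact: linearZ. Qed.

End Transpose.

Section Forms.
Context {K : realType} {m : nat}.
Implicit Types (M X P : 'M[K]_m) (v w : 'cV[K]_m).

Lemma qformD M X v : qform (M + X) v = qform M v + qform X v.
Proof. by rewrite /qform mulmxDr mulmxDl mxE. Qed.

Lemma qformN M v : qform (- M) v = - qform M v.
Proof. by rewrite /qform mulmxN mulNmx mxE. Qed.

Lemma qformB M X v : qform (M - X) v = qform M v - qform X v.
Proof. by rewrite qformD qformN. Qed.

Lemma qformZ c M v : qform (c *: M) v = c * qform M v.
Proof. by rewrite /qform -scalemxAr -scalemxAl mxE. Qed.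

Lemma qform0 v : qform 0 v = 0.
Proof. by rewrite /qform mulmx0 mul0mx mxE. Qed.

Lemma qform0v M : qform M 0 = 0.
Proof. by rewrite /qform mulmx0 mxE. Qed.

Lemma qformZv c M v : qform M (c *: v) = c ^+ 2 * qform M v.
Proof.
by rewrite /qform trmxZ -!scalemxAl -scalemxAr !mxE mulrA.
Qed.

Lemma qformDv M v w : qform M (v + w) =
  qform M v + (v^T *m M *m w) 0 0 + (w^T *m M *m v) 0 0 + qform M w.
Proof.
rewrite [LHS]/qform trmxD mulmxDl !mulmxDr !mulmxDl.
have E (p q s t : 'M[K]_1) :
    (p + s + (q + t)) 0 0 = p 0 0 + q 0 0 + s 0 0 + t 0 0 by rewrite !mxE; ring.
by rewrite E addrAC.
Qed.

Lemma mx11_tr (s : 'M[K]_1) : s^T = s.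
Proof. by rewrite (mx11_scalar s) tr_scalar_mx. Qed.

Lemma qform_tr M v : qform M^T v = qform M v.
Proof.
by rewrite /qform -[in LHS](mx11_tr (_ *m v)) !trmx_mul !trmxK mulmxA.
Qed.

Lemma qform_mulmx {r} (N : 'M[K]_r) (B : 'M[K]_(r, m)) v :
  qform N (B *m v) = qform (B^T *m N *m B) v.
Proof. by rewrite /qform trmx_mul !mulmxA. Qed.

Lemma qform1E v : qform 1%:M v = \sum_i v i 0 ^+ 2.
Proof.
rewrite /qform mulmx1 mxE; apply: eq_bigr => i _.
by rewrite mxE expr2.
Qed.

Lemma posdef1 : sym_posdef (1%:M : 'M[K]_m).
Proof.
split; first exact: trmx1.
move=> v v0; rewrite qform1E lt_neqAle sumr_ge0 ?andbT; last first.
  by move=> i _; rewrite sqr_ge0.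
rewrite eq_sym; apply: contra v0; rewrite psumr_eq0; last first.
  by move=> i _; rewrite sqr_ge0.
move=> /allP s0; apply/eqP/colP => i; rewrite mxE.
by apply/eqP; rewrite -sqrf_eq0; apply: s0; rewrite mem_index_enum.
Qed.

Lemma posdef_ge0 {P} v : sym_posdef P -> 0 <= qform P v.
Proof.
move=> [_ P0]; have [->|v0] := eqVneq v 0; first by rewrite qform0v.
exact/ltW/P0.
Qed.

(** A small step from a null vector [v] in the direction [- M v] would make
    the form negative unless [M v = 0]. *)
Lemma psd_null M v : M^T = M -> (forall w, 0 <= qform M w) ->
  qform M v = 0 -> M *m v = 0.
Proof.
move=> Ms M0 qv; apply/eqP; apply: contraT => Mv0.
set w := M *m v; pose b := qform 1%:M w; pose c := qform M w.
have b0 : 0 < b by apply: (posdef1).2.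
have c0 : 0 <= c by exact: M0.
have wMv : (w^T *m M *m v) 0 0 = b by rewrite /b /qform mulmx1 -mulmxA.
have vMw : (v^T *m M *m w) 0 0 = b.
  by rewrite -wMv -[in LHS](mx11_tr (_ *m w)) !trmx_mul trmxK Ms mulmxA.
(* The minimiser is [- b / c]; adding [1] covers the case [c = 0]. *)
pose t := - b / (c + 1).
have : 0 <= qform M (v + t *: w) by [].
have -> : qform M (v + t *: w) = qform M v + 2 * t * b + t ^+ 2 * c.
  rewrite qformDv qformZv trmxZ -scalemxAr -!scalemxAl.
  have E (a : K) (p : 'M[K]_1) : (a *: p) 0 0 = a * p 0 0 by rewrite mxE.
  rewrite !E vMw wMv -/c; ring.
rewrite qv; have tE : t * (c + 1) = - b by rewrite /t divfK // gt_eqF //; lra.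
have t0 : t < 0 by rewrite /t mulNr oppr_lt0 divr_gt0 //; lra.
nra.
Qed.

Lemma sym_qform_inj M X : M^T = M -> X^T = X ->
  (forall v, qform M v = qform X v) -> M = X.
Proof.
move=> Ms Xs MX; apply/eqP; rewrite -subr_eq0; apply/eqP.
have q0 v : qform (M - X) v = 0 by rewrite qformB MX subrr.
have Z v : (M - X) *m v = 0.
  by apply: psd_null => // [|w]; rewrite ?q0 // trmxB Ms Xs.
apply/matrixP => i j; have := Z (delta_mx j 0).
by rewrite -colE => /colP/(_ i); rewrite !mxE.
Qed.

End Forms.

(** * Limits of matrices, and ratios of forms *)

Section MatrixLimits.
Context {K : realType} {T : Type} {F : set_system T} {FF : Filter F}.

Lemma cvg_mx {m n} (f : T -> 'M[K]_(m, n)) (l : 'M[K]_(m, n)) :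
  (forall i j, f x i j @[x --> F] --> l i j) -> f x @[x --> F] --> l.
Proof.
move=> fl; apply/cvgrPdist_le => /= e e0; near=> x.
rewrite /Num.Def.normr/= mx_normrE (bigmax_le _ (ltW e0))//= => i _.
rewrite !mxE/=; move: i; near: x; apply: filter_forall => /= i.
exact: ((cvgrPdist_le _ _).1 (fl i.1 i.2)).
Unshelve. all: by end_near. Qed.

Lemma cvg_entry {m n} (f : T -> 'M[K]_(m, n)) (l : 'M[K]_(m, n)) i j :
  f x @[x --> F] --> l -> f x i j @[x --> F] --> l i j.
Proof.
move=> fl; have c : {for l, continuous (fun M : 'M[K]_(m, n) => M i j)}.
  exact: coord_continuous.
by have := continuous_cvg FF c fl.
Qed.

Lemma cvg_mulmx {m n p} (f : T -> 'M[K]_(m, n)) (g : T -> 'M[K]_(n, p))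
    (a : 'M[K]_(m, n)) (b : 'M[K]_(n, p)) :
  f x @[x --> F] --> a -> g x @[x --> F] --> b ->
  f x *m g x @[x --> F] --> a *m b.
Proof.
move=> fa gb; apply: cvg_mx => i j; rewrite !mxE.
under eq_cvg do rewrite mxE.
apply: cvg_big => [|k _]; first exact: add_continuous.
by apply: cvgM; exact: cvg_entry.
Qed.

Lemma cvg_trmx {m n} (f : T -> 'M[K]_(m, n)) (a : 'M[K]_(m, n)) :
  f x @[x --> F] --> a -> (f x)^T @[x --> F] --> a^T.
Proof.
move=> fa; apply: cvg_mx => i j; rewrite !mxE.
by under eq_cvg do rewrite mxE; exact: cvg_entry.
Qed.

Lemma cvg_qform {m} (f : T -> 'M[K]_m) (g : T -> 'cV[K]_m)
    (a : 'M[K]_m) (b : 'cV[K]_m) :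
  f x @[x --> F] --> a -> g x @[x --> F] --> b ->
  qform (f x) (g x) @[x --> F] --> qform a b.
Proof.
move=> fa gb; apply: cvg_entry; apply: cvg_mulmx => //.
by apply: cvg_mulmx => //; exact: cvg_trmx.
Qed.

End MatrixLimits.

Section MinRatio.
Context {K : realType}.

(** The ratio of the two forms is homogeneous of degree [0], so its minimum over
    the compact unit sphere is a minimum over all nonzero vectors. *)
Lemma min_ratio {m} (X P : 'M[K]_m) (w : 'cV[K]_m) :
  sym_posdef P -> w != 0 ->
  exists c, exists2 v : 'cV[K]_m, v != 0 &
    qform X v = c * qform P v /\ forall u, c * qform P u <= qform X u.
Proof.
move=> pP w0; pose S := [set v : 'rV[K]_m | `|v| = 1].
have normalize (u : 'cV[K]_m) : u != 0 ->
    exists2 k, 0 < k & S ((k *: u)^T).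
  move=> u0; exists (`|u^T|^-1).
    by rewrite invr_gt0 normr_gt0 trmx_eq0.
  rewrite /S /= trmxZ normrZ normfV normr_id mulVf //.
  by rewrite normr_eq0 trmx_eq0.
have S0 v : S v -> v^T != 0.
  by rewrite /S /= => Sv; rewrite trmx_eq0 -normr_eq0 Sv oner_neq0.
have SN0 : S !=set0.
  by have [k _ ?] := normalize _ w0; eexists; eassumption.
have Sc : compact S.
  apply: bounded_closed_compact.
    by exists 1; split => // k k1 u /= Su; rewrite Su ltW.
  by apply: (@preimage_closed _ _ (fun v : 'rV[K]_m => `|v|) [set 1]);
    [move=> v _; exact: norm_continuous | exact: closed_eq].
have cont : {within S, continuous (fun v => qform X v^T / qform P v^T)}.
  apply: continuous_in_subspaceT => v; rewrite inE => Sv.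
  have c Y : qform Y u^T @[u --> v] --> qform Y v^T.
    have fv := nbhs_filter v.
    have cY : (fun=> Y) u @[u --> v] --> Y by apply: cvg_cst.
    by have := @cvg_qform _ _ _ fv _ _ trmx Y v^T cY
      (@cvg_trmx _ _ _ fv _ _ id v cvg_id).
  have d : (qform P u^T)^-1 @[u --> v] --> (qform P v^T)^-1.
    have P0 : qform P v^T != 0 by rewrite gt_eqF //; apply: pP.2; exact: S0.
    exact (cvgV P0 (c P)).
  exact (cvgM (c X) d).
have [v vS vmin] := compact_EVT_min SN0 Sc cont.
rewrite inE in vS; have v0 := S0 _ vS; have Pv := pP.2 _ v0.
exists (qform X v^T / qform P v^T), v^T => //; split=> [|u].
  by rewrite divfK // gt_eqF.
have [->|u0] := eqVneq u 0; first by rewrite !qform0v mulr0.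
have [k k0 Sk] := normalize _ u0.
have := vmin _ (mem_set Sk); rewrite trmxK !qformZv -mulf_div divff; last first.
  by rewrite expf_neq0 // gt_eqF.
by rewrite mul1r ler_pdivlMr //; exact: pP.2.
Qed.

Lemma posdef_dominates {m} (X P : 'M[K]_m) : sym_posdef P ->
  exists2 c, 0 < c & forall v, qform X v <= c * qform P v.
Proof.
move=> pP.
(* In dimension [0] there is no nonzero vector to minimise over. *)
have [[w w0]|N] := pselect (exists w : 'cV[K]_m, w != 0).
  have [c [v v0 [_ cP]]] := min_ratio (- X) P w pP w0.
  exists (`|c| + 1) => [|u]; first by rewrite ltr_wpDl.
  have := cP u; rewrite qformN; have := posdef_ge0 u pP.
  have := ler_norm (- c); rewrite normrN; nra.
exists 1 => // v; have -> : v = 0; last by rewrite !qform0v mulr0.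
by apply/eqP; apply: contra_notT N => v0; exists v.
Qed.

End MinRatio.

(** * Lyapunov operators *)

Section Lyapunov.
Context {K : realType} {m : nat}.
Implicit Types (M X P W : 'M[K]_m) (v : 'cV[K]_m).

(** The derivative of the form [X] along [x' = M x] is the form [lyap M X]. *)
Definition lyap M X := M^T *m X + X *m M.

(** By Lyapunov's theorem this is stability. The certificate [P] is what every
    argument below manipulates; eigenvalues enter only in [lyap_stable_stable]. *)
Definition lyap_stable M := exists2 P, sym_posdef P &
  forall v, v != 0 -> qform (lyap M P) v < 0.

Lemma lyapB M X W : lyap M (X - W) = lyap M X - lyap M W.
Proof. by rewrite /lyap mulmxBr mulmxBl opprD addrACA. Qed.

Lemma lyap_tr M X : (lyap M X)^T = lyap M X^T.
Proof. by rewrite /lyap trmxD !trmx_mul trmxK addrC. Qed.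

Lemma qform_lyap M X v : X^T = X ->
  qform (lyap M X) v = ((M *m v)^T *m (X *m v)) 0 0 *+ 2.
Proof.
move=> Xs; rewrite /lyap qformD.
have -> : qform (X *m M) v = qform (M^T *m X) v.
  by rewrite -qform_tr trmx_mul Xs.
by rewrite -mulr2n /qform trmx_mul !mulmxA.
Qed.

(** At a minimiser [v] of the ratio of [X] to a Lyapunov form [P], with minimal
    value [c], the form [X - c P] is nonnegative and vanishes at [v], so
    [X v = c P v] and the derivatives of the two forms at [v] have ratio [c]. *)
Lemma lyap_compare M X : lyap_stable M -> X^T = X ->
  (forall v, qform (lyap M X) v <= 0) -> forall v, 0 <= qform X v.
Proof.
move=> [P pP MP] Xs MX u; have [->|u0] := eqVneq u 0; first by rewrite qform0v.
have [c [v v0 [Xv cP]]] := min_ratio X P u pP u0.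
have XPv : X *m v = c *: (P *m v).
  apply/eqP; rewrite -subr_eq0 scalemxAl -mulmxBl; apply/eqP.
  apply: psd_null => [|w|]; first by rewrite trmxB trmxZ Xs pP.1.
    by rewrite qformB qformZ subr_ge0.
  by rewrite qformB qformZ Xv subrr.
have : qform (lyap M X) v = c * qform (lyap M P) v.
  by rewrite !qform_lyap ?pP.1 // XPv -scalemxAr mxE mulrnAr.
have := MX v; have := MP v v0 => Pv XMv E.
have c0 : 0 <= c by nra.
by apply: le_trans (cP u); rewrite mulr_ge0 // posdef_ge0.
Qed.

(** The operator [X |-> lyap M (X + X^T) + (X - X^T)] is injective: its
    antisymmetric part forces [X] to be symmetric, after which comparison
    applies to [X] and to [- X]. Being linear, it is surjective. *)
Lemma lyap_solve M W : lyap_stable M -> W^T = W ->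
  exists2 P, P^T = P & lyap M P = W.
Proof.
move=> sM Ws; pose f (X : 'M[K]_m) := lyap M (X + X^T) + (X - X^T).
have sym_of X Y : Y^T = Y -> f X = Y -> X^T = X /\ lyap M (X + X^T) = Y.
  (* Transposing [f X = Y] only changes the sign of [X - X^T]. *)
  move=> Ys fX; have E : lyap M (X + X^T) - (X - X^T) = Y.
    rewrite -Ys -fX trmxD lyap_tr trmxD trmxK trmxB trmxK.
    by rewrite [X^T + X]addrC opprB.
  have XX : X - X^T = 0.
    apply/matrixP => i j.
    move: (congr1 (fun N : 'M[K]_m => N i j) (etrans fX (esym E))).
    by rewrite !mxE; lra.
  split; first by apply/esym/eqP; rewrite -subr_eq0 XX.
  by rewrite -fX /f XX addr0.
have f_lin : linear f.
  move=> a X Y; rewrite /f /lyap; apply/matrixP => i j.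
  rewrite !trmxD !trmxZ !(mulmxDr, mulmxDl) -!scalemxAr -!scalemxAl.
  by rewrite !mxE; ring.
pose fL : {linear 'M[K]_m -> 'M[K]_m} :=
  HB.pack f (GRing.isLinear.Build _ _ _ _ f f_lin).
pose F : 'End('M[K]_m) := linfun fL.
have kerF : lker F == 0%VS.
  apply/eqP/vspaceP => X; rewrite memv_ker memv0 lfunE /=.
  apply/eqP/eqP => [fX|->]; last exact: (linear0 fL).
  have [Xs lX] := sym_of X 0 (trmx0 _ _ _) fX.
  have {}lX : lyap M (X + X) = 0 by rewrite -[X in _ + X]Xs.
  have q0 : forall v, qform (lyap M X) v = 0.
    move=> v; have : qform (lyap M (X + X)) v = 0 by rewrite lX qform0.
    by rewrite /lyap mulmxDr mulmxDl addrACA qformD; lra.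
  apply: sym_qform_inj; rewrite ?trmx0 // => v; rewrite qform0; apply: le_anti.
  rewrite (lyap_compare M X) ?andbT // => [|w]; last by rewrite q0.
  rewrite -oppr_ge0 -qformN; apply: (lyap_compare M) => //.
    by rewrite trmxN Xs.
  move=> w; rewrite -[- X]sub0r lyapB qformB q0 /lyap mulmx0 mul0mx addr0.
  by rewrite qform0 subr0.
have [X fX] : exists X, f X = W.
  exists (F^-1%VF W); have := lker0_lfunVK kerF W; by rewrite lfunE.
have [Xs lX] := sym_of X W Ws fX.
by exists (X + X^T) => //; rewrite trmxD trmxK addrC.
Qed.

(** Comparison gives semidefiniteness, and at a null vector of [P] the
    derivative of [P] would vanish. *)
Lemma lyap_posdef M P : lyap_stable M -> P^T = P ->
  (forall v, v != 0 -> qform (lyap M P) v < 0) -> sym_posdef P.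
Proof.
move=> sM Ps MP; split=> // v v0.
have P0 : forall w, 0 <= qform P w.
  apply: (lyap_compare M) => // w; have [->|/MP/ltW//] := eqVneq w 0.
  by rewrite qform0v.
rewrite lt_neqAle P0 andbT; apply/eqP => /esym qv.
have := MP v v0; rewrite qform_lyap // (psd_null P v) // mulmx0 mxE mul0rn.
by rewrite ltxx.
Qed.

End Lyapunov.

Section LyapunovStable.
Context {K : realType} {m : nat}.
Implicit Types (M X P W : 'M[K]_m) (v : 'cV[K]_m).

Lemma posdef_unit P : sym_posdef P -> P \in unitmx.
Proof.
move=> pP; rewrite -row_free_unit -kermx_eq0; apply/eqP/row_matrixP => i.
rewrite row0; apply/eqP; apply: contraT; rewrite -trmx_eq0 => /pP.2.
by rewrite /qform trmxK -row_mul mulmx_ker row0 mul0mx mxE ltxx.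
Qed.

Lemma posdef_inv_tr P : sym_posdef P -> (invmx P)^T = invmx P.
Proof. by move=> pP; rewrite trmx_inv pP.1. Qed.

Lemma posdef_inv P : sym_posdef P -> sym_posdef (invmx P).
Proof.
move=> pP; have uP := posdef_unit P pP.
split=> [|v v0]; first exact: posdef_inv_tr.
have -> : qform (invmx P) v = qform P (invmx P *m v).
  by rewrite /qform trmx_mul posdef_inv_tr // mulmxKV // mulmxA.
apply: pP.2; apply: contra v0 => /eqP E.
by rewrite -[v](mulKVmx uP) E mulmx0.
Qed.

(** The inverse of a Lyapunov form for [M] is one for [M^T]. *)
Lemma lyap_stable_tr M : lyap_stable M -> lyap_stable M^T.
Proof.
move=> [P pP MP]; exists (invmx P); first exact: posdef_inv.
have uP := posdef_unit P pP; move=> v v0; rewrite -[v](mulKVmx uP).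
have -> : qform (lyap M^T (invmx P)) (P *m (invmx P *m v)) =
    qform (lyap M P) (invmx P *m v).
  rewrite qform_mulmx pP.1 /lyap trmxK mulmxDr mulmxDl addrC; congr qform.
  by rewrite !mulmxA mulmxV // mul1mx mulmxKV.
apply: MP; apply: contra v0 => /eqP E.
by rewrite -[v](mulKVmx uP) E mulmx0.
Qed.

(** For a left eigenvector [a + i b] with eigenvalue [s + i t] and a Lyapunov
    form [P] of [M^T], symmetry of [P] cancels the terms with [t], leaving
    [2 s (P[a] + P[b])] as the sum of the derivatives of [P] at [a] and [b]. *)
Lemma lyap_stable_stable M : lyap_stable M -> stable M.
Proof.
move=> /lyap_stable_tr[P pP MP] l /eigenvalueP[w wM w0].
pose s := complex.Re l; pose t := complex.Im l.
pose a := (map_mx (@complex.Re K) w)^T; pose b := (map_mx (@complex.Im K) w)^T.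
have ReD : {morph (@complex.Re K) : x y / x + y} by case=> ? ? [? ?].
have ImD : {morph (@complex.Im K) : x y / x + y} by case=> ? ? [? ?].
have aM : M^T *m a = s *: a - t *: b.
  apply/colP => j; rewrite !mxE; move/matrixP/(_ 0 j)/(congr1 (@complex.Re K)): wM.
  rewrite !mxE (big_morph _ ReD (erefl _)) => E.
  transitivity (complex.Re (l * w 0 j)).
    rewrite -E; apply: eq_bigr => k _; rewrite !mxE mulrC.
    by case: (w 0 k) => x y /=; rewrite mulr0 subr0.
  by rewrite /s /t; case: (l); case: (w 0 j).
have bM : M^T *m b = t *: a + s *: b.
  apply/colP => j; rewrite !mxE; move/matrixP/(_ 0 j)/(congr1 (@complex.Im K)): wM.
  rewrite !mxE (big_morph _ ImD (erefl _)) => E.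
  transitivity (complex.Im (l * w 0 j)).
    rewrite -E; apply: eq_bigr => k _; rewrite !mxE mulrC.
    by case: (w 0 k) => x y /=; rewrite mulr0 add0r.
  by rewrite /s /t; case: (l) => ? ?; case: (w 0 j) => ? ? /=; rewrite addrC.
have ab0 : (a != 0) || (b != 0).
  rewrite -negb_and; apply: contra w0 => /andP[/eqP a0 /eqP b0].
  apply/eqP/rowP => j; rewrite mxE.
  move/colP/(_ j): a0; move/colP/(_ j): b0; rewrite !mxE.
  by case: (w 0 j) => x y /= -> ->.
clearbody a b.
have E : qform (lyap M^T P) a + qform (lyap M^T P) b =
    s * (qform P a + qform P b) *+ 2.
  rewrite !qform_lyap ?pP.1 // aM bM !trmxB !trmxD !trmxZ mulmxBl mulmxDl.
  have abP : (b^T *m (P *m a)) 0 0 = (a^T *m (P *m b)) 0 0.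
    by rewrite -[in LHS](mx11_tr (b^T *m _)) !trmx_mul trmxK pP.1 mulmxA.
  rewrite -!scalemxAl -mulrnDl; congr (_ *+ 2); rewrite /qform -!mulmxA.
  move: (a^T *m (P *m a)) (b^T *m (P *m a)) (a^T *m (P *m b)) (b^T *m (P *m b))
    abP.
  by move=> x y z u; rewrite !mxE => ->; ring.
have neg : qform (lyap M^T P) a + qform (lyap M^T P) b < 0.
  have le0 v : qform (lyap M^T P) v <= 0.
    by have [->|/MP/ltW//] := eqVneq v 0; rewrite qform0v.
  by case/orP: ab0 => /MP; [have := le0 b|have := le0 a]; lra.
have pos : 0 <= qform P a + qform P b by rewrite addr_ge0 // posdef_ge0.
by rewrite -/s; nra.
Qed.

End LyapunovStable.

(** * Riccati equations and policy iteration *)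

Lemma cvg_seq_unique {K : realType} {m n} (f : nat -> 'M[K]_(m, n))
    (a b : 'M[K]_(m, n)) :
  f k @[k --> \oo] --> a -> f k @[k --> \oo] --> b -> a = b.
Proof. by move=> fa fb; apply: (cvg_unique _ fa fb); exact: norm_hausdorff. Qed.

(** Polarization: the entry [(i, j)] of a symmetric matrix is a difference of
    values of its form, so monotone convergence of all the values gives
    convergence of the matrices. *)
Lemma psd_monotone_cvg {K : realType} {m} (P : nat -> 'M[K]_m) :
  (forall k, (P k)^T = P k) -> (forall k v, 0 <= qform (P k) v) ->
  (forall k v, qform (P k.+1) v <= qform (P k) v) ->
  exists2 L, P k @[k --> \oo] --> (L : 'M[K]_m) &
    L^T = L /\ forall v, 0 <= qform L v.
Proof.
move=> Ps P0 Pd.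
have cq v : cvgn (fun k => qform (P k) v).
  apply: nonincreasing_is_cvgn; last by exists 0 => _ [k _ <-]; exact: P0.
  by apply/nonincreasing_seqP => k; exact: Pd.
have polar k i j : P k i j = (qform (P k) (delta_mx i 0 + delta_mx j 0) -
    qform (P k) (delta_mx i 0) - qform (P k) (delta_mx j 0)) / 2.
  have E x y : ((delta_mx x (0 : 'I_1))^T *m P k *m delta_mx y (0 : 'I_1)) 0 0 = P k x y.
    by rewrite trmx_delta -rowE -colE !mxE.
  have sym : P k j i = P k i j by rewrite -{1}(Ps k) mxE.
  by rewrite qformDv !E sym; field.
pose q v := limn (fun k => qform (P k) v).
pose L : 'M[K]_m := \matrix_(i, j)
  ((q (delta_mx i 0 + delta_mx j 0) - q (delta_mx i 0) - q (delta_mx j 0)) / 2).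
have PL : P k @[k --> \oo] --> L.
  apply: cvg_mx => i j; rewrite mxE (funext (fun k => polar k i j)).
  exact: cvgMl (cvgB (cvgB (cq _) (cq _)) (cq _)).
exists L => //; split=> [|v].
  apply: (cvg_seq_unique P) => //.
  have : (P k)^T @[k --> \oo] --> L^T by exact: cvg_trmx.
  by rewrite (funext Ps).
have : qform (P k) v @[k --> \oo] --> qform L v.
  by apply: (cvg_qform _ (fun=> v)) => //; apply: cvg_cst.
move=> /cvg_lim <- //; apply: limr_ge; first exact: cq.
by apply: nearW => k; exact: P0.
Qed.

Section Riccati.
Context {K : realType} {m r : nat}.
Context {A : 'M[K]_m} {B : 'M[K]_(m, r)} {Q : 'M[K]_m} {R : 'M[K]_r}.
Implicit Types (F : 'M[K]_(r, m)) (P : 'M[K]_m) (v : 'cV[K]_m).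

(** The running cost under the feedback [F] plus the time derivative of the
    form [P] along the closed loop. For positive definite [P], it is [0] exactly
    when [P] is the cost of [F] as a form in the initial state. *)
Definition resid F P := lyap (A + B *m F) P + (Q + F^T *m R *m F).

Definition gain P : 'M[K]_(r, m) := - (invmx R *m B^T *m P).

Hypotheses (hQ : sym_posdef Q) (hR : sym_posdef R).

(** Completion of the square in [F]: a solution of the Riccati equation has a
    nonnegative residual at every feedback, which vanishes at its own gain. *)
Lemma resid_gain F P : P^T = P ->
  resid F P = (A^T *m P + P *m A - P *m B *m invmx R *m B^T *m P + Q) +
    (F - gain P)^T *m R *m (F - gain P).
Proof.
move=> Ps; set G := gain P; have uR := posdef_unit R hR.
have RG : R *m G = - (B^T *m P) by rewrite mulmxN !mulmxA mulmxV // mul1mx.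
have GR : G^T *m R = - (P *m B).
  by rewrite -[LHS]trmxK trmx_mul trmxK hR.1 RG trmxN trmx_mul trmxK Ps.
have -> : (F - G)^T *m R *m (F - G) = F^T *m R *m F + F^T *m B^T *m P +
    P *m B *m F + P *m B *m invmx R *m B^T *m P.
  rewrite trmxB mulmxBl GR mulmxBr !mulmxBl -(mulmxA F^T R G) RG.
  rewrite /G /gain !(mulmxN, mulNmx) !mulmxA.
  by apply/matrixP => i j; rewrite !mxE; ring.
rewrite /resid /lyap trmxD trmx_mul mulmxDl mulmxDr !mulmxA.
by apply/matrixP => i j; rewrite !mxE; ring.
Qed.

Lemma riccati_solE P :
  riccati_sol A B Q R P <-> sym_posdef P /\ resid (gain P) P = 0.
Proof.
split=> -[pP E]; split=> //; move: E; rewrite resid_gain ?pP.1 // subrr.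
  by rewrite mulmx0 addr0.
by rewrite mulmx0 addr0.
Qed.

Lemma qform_resid F P v :
  qform (resid F P) v = qform (lyap (A + B *m F) P) v + qform Q v + qform R (F *m v).
Proof. by rewrite /resid !qformD qform_mulmx addrA. Qed.

Lemma riccati_resid_ge0 P F v : riccati_sol A B Q R P -> 0 <= qform (resid F P) v.
Proof.
move=> [pP E]; rewrite resid_gain ?pP.1 // E add0r -qform_mulmx.
exact: posdef_ge0.
Qed.

Lemma resid_lyap_stable F P : sym_posdef P ->
  (forall v, qform (resid F P) v <= 0) -> lyap_stable (A + B *m F).
Proof.
move=> pP FP; exists P => // v v0; have := FP v; rewrite qform_resid.
have := hQ.2 v v0; have := posdef_ge0 (F *m v) hR; lra.
Qed.

(** The cost-to-go form of a stabilizing feedback. *)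
Lemma resid_solve F : lyap_stable (A + B *m F) ->
  exists2 P, sym_posdef P & resid F P = 0.
Proof.
move=> sF; have Ws : (- (Q + F^T *m R *m F))^T = - (Q + F^T *m R *m F).
  by rewrite trmxN trmxD !trmx_mul trmxK hQ.1 hR.1 mulmxA.
have [P Ps PF] := lyap_solve _ _ sF Ws; exists P; last by rewrite /resid PF addNr.
apply: (lyap_posdef _ _ sF) => // v v0; rewrite PF qformN qformD oppr_lt0.
by rewrite -qform_mulmx ltr_wpDr ?posdef_ge0 //; exact: hQ.2.
Qed.

(** The derivative of [P - P'] along the closed loop is the difference of the
    residuals, so comparison reverses their order. *)
Lemma resid_le F P P' : lyap_stable (A + B *m F) -> P^T = P -> P'^T = P' ->
  (forall v, qform (resid F P') v <= qform (resid F P) v) ->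
  forall v, qform P v <= qform P' v.
Proof.
move=> sF Ps Ps' FP v; rewrite -subr_ge0 -qformB.
apply: (lyap_compare _ _ sF); first by rewrite trmxB Ps Ps'.
by move=> w; rewrite lyapB qformB; have := FP w; rewrite !qform_resid; lra.
Qed.

Lemma riccati_stable P : riccati_sol A B Q R P -> lyap_stable (A + B *m gain P).
Proof.
move=> /riccati_solE[pP E]; apply: (resid_lyap_stable _ P) => // v.
by rewrite E qform0.
Qed.

(** Of two solutions each has residual [0] at its own gain, where the other has a
    nonnegative one, so each lies below the other. *)
Lemma riccati_unique P P' :
  riccati_sol A B Q R P -> riccati_sol A B Q R P' -> P = P'.
Proof.
have le P1 P2 : riccati_sol A B Q R P1 -> riccati_sol A B Q R P2 ->
    forall v, qform P1 v <= qform P2 v.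
  move=> s1 s2; have [[p1 _] [p2 E2]] := (s1, (riccati_solE P2).1 s2).
  apply: (resid_le (gain P2)) => //; [exact: riccati_stable|exact: p1.1|exact: p2.1|].
  by move=> v; rewrite E2 qform0 riccati_resid_ge0.
move=> s s'; apply: sym_qform_inj; [exact: s.1.1|exact: s'.1.1|move=> v].
by apply: le_anti; rewrite !le.
Qed.

Lemma cvg_resid (F : nat -> 'M[K]_(r, m)) (P : nat -> 'M[K]_m)
    (G : 'M[K]_(r, m)) (L : 'M[K]_m) :
  F k @[k --> \oo] --> G -> P k @[k --> \oo] --> L ->
  resid (F k) (P k) @[k --> \oo] --> resid G L.
Proof.
move=> FG PL.
have cA : A + B *m F k @[k --> \oo] --> A + B *m G.
  by apply: cvgD; [exact: cvg_cst|apply: cvg_mulmx => //; exact: cvg_cst].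
apply: cvgD.
  by apply: cvgD; apply: cvg_mulmx => //; exact: cvg_trmx.
apply: cvgD; first exact: cvg_cst.
apply: cvg_mulmx => //; apply: cvg_mulmx; first exact: cvg_trmx.
exact: cvg_cst.
Qed.

Lemma cvg_gain (P : nat -> 'M[K]_m) (L : 'M[K]_m) :
  P k @[k --> \oo] --> L -> gain (P k) @[k --> \oo] --> gain L.
Proof. by move=> PL; apply: cvgN; apply: cvg_mulmx => //; exact: cvg_cst. Qed.

(** A limit of policy iteration solves the Riccati equation. It is only
    obviously semidefinite; but a null vector [v] of [L] makes the derivative of
    [L] vanish, so the equation leaves [Q[v] <= 0]. *)
Lemma policy_limit (F : nat -> 'M[K]_(r, m)) (P : nat -> 'M[K]_m) (L : 'M[K]_m) :
  (forall k, resid (F k) (P k) = 0) -> P k @[k --> \oo] --> L ->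
  F k @[k --> \oo] --> gain L -> L^T = L -> (forall v, 0 <= qform L v) ->
  riccati_sol A B Q R L.
Proof.
move=> FP PL FG Ls L0; have E : resid (gain L) L = 0.
  apply: (cvg_seq_unique (fun k => resid (F k) (P k))); first exact: cvg_resid.
  by under eq_cvg do rewrite FP; exact: cvg_cst.
apply/riccati_solE; split=> //; split=> // v v0.
rewrite lt_neqAle L0 andbT; apply/eqP => /esym qv.
have : qform (resid (gain L) L) v = 0 by rewrite E qform0.
rewrite qform_resid qform_lyap // (psd_null L v) // mulmx0 mxE mul0rn.
have := hQ.2 v v0; have := posdef_ge0 (gain L *m v) hR; lra.
Qed.

(** Replacing a feedback by the gain of its cost form drops the square in
    [resid_gain], so the form becomes an upper bound for the new cost. *)
Lemma gain_improves F P : P^T = P -> resid F P = 0 ->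
  forall v, qform (resid (gain P) P) v <= 0.
Proof.
move=> Ps FP v; rewrite resid_gain // subrr mulmx0 addr0.
move: FP; rewrite resid_gain // => /eqP; rewrite addr_eq0 => /eqP ->.
by rewrite qformN -qform_mulmx oppr_le0 posdef_ge0.
Qed.

(** Policy iteration from a stabilizing feedback: evaluate the feedback by its
    Lyapunov equation, replace it by the gain of the resulting form. Each step
    keeps stability and lowers the form, so the forms converge. *)
Lemma riccati_exists F : lyap_stable (A + B *m F) -> exists P, riccati_sol A B Q R P.
Proof.
move=> sF; pose val F := get [set P | sym_posdef P /\ resid F P = 0].
have valP G : lyap_stable (A + B *m G) -> sym_posdef (val G) /\ resid G (val G) = 0.
  move=> /resid_solve[P pP GP].
  by apply: (getPex (P := [set P | sym_posdef P /\ resid G P = 0])); exists P.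
pose Fk k := iter k (fun G => gain (val G)) F.
have sk k : lyap_stable (A + B *m Fk k).
  elim: k => // k /valP[pP FP]; apply: (resid_lyap_stable _ (val (Fk k))) => //.
  by apply: (gain_improves (Fk k)) => //; exact: pP.1.
have pk k : sym_posdef (val (Fk k)) by case: (valP _ (sk k)).
have rk k : resid (Fk k) (val (Fk k)) = 0 by case: (valP _ (sk k)).
have [L PL [Ls L0]] : exists2 L, val (Fk k) @[k --> \oo] --> (L : 'M[K]_m) &
    L^T = L /\ forall v, 0 <= qform L v.
  apply: psd_monotone_cvg => k; [exact: (pk k).1|by move=> v; exact: posdef_ge0|].
  apply: (resid_le (Fk k.+1)) => [|||v]; [exact: sk|exact: (pk _).1|exact: (pk _).1|].
  by rewrite rk qform0; apply: (gain_improves (Fk k)) => //; exact: (pk k).1.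
exists L; apply: (policy_limit (fun k => Fk k.+1) (fun k => val (Fk k.+1))) => //.
  by move: PL; rewrite -cvg_shiftS.
exact: cvg_gain.
Qed.

Lemma riccati_exists_unique F :
  lyap_stable (A + B *m F) -> exists! P, riccati_sol A B Q R P.
Proof.
move=> /riccati_exists[P sP]; exists P; split=> // P' sP'.
exact: riccati_unique.
Qed.

End Riccati.

Arguments resid {K m r} A B Q R F P.
Arguments gain {K m r} B R P.

(** * The split iteration *)

(** A sequence that at each step either stays put or jumps to the current value
    of a convergent sequence [b], and jumps infinitely often, has the limit of
    [b]: once it has jumped late enough, it stays close to that limit. *)
Lemma cvg_sampled {K : realType} {m n} (a b : nat -> 'M[K]_(m, n))
    (l : 'M[K]_(m, n)) :
  b k @[k --> \oo] --> l ->
  (forall k, a k.+1 = b k \/ a k.+1 = a k) ->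
  (forall N, exists2 k, (N <= k)%N & a k.+1 = b k) ->
  a k @[k --> \oo] --> l.
Proof.
move=> bl step often; apply/cvgrPdist_le => e e0.
have [N _ bN] := (cvgrPdist_le _ _).1 bl e e0.
have [k Nk ak] := often N; exists k.+1 => // p /= kp; rewrite -(subnKC kp).
elim: (p - k.+1)%N => [|d IH]; first by rewrite addn0 ak; exact: bN.
rewrite addnS; case: (step (k.+1 + d)%N) => -> //; apply: bN => /=.
by rewrite (leq_trans Nk) // addSn ltnW // ltnS leq_addr.
Qed.

Lemma sweepE n (i : 'I_n) k : sweep i k = ((i + k) %% n)%N :> nat.
Proof.
rewrite /sweep; elim: k => [|k IH] /=; first by rewrite addn0 modn_small.
by rewrite IH -addn1 modnDml addn1 addnS.
Qed.

Lemma sweep_often n (i j : 'I_n) N : exists2 k, (N <= k)%N & sweep i k = j.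
Proof.
have n0 : (0 < n)%N by exact: leq_ltn_trans (ltn_ord i).
(* Complete the turn that is under way at step [N], then go on to [j]. *)
exists (N + (n - (i + N) %% n + j))%N; first exact: leq_addr.
apply: val_inj; rewrite /= sweepE addnA.
have -> : (i + N + (n - (i + N) %% n + j) = ((i + N) %/ n).+1 * n + j)%N.
  rewrite {1}(divn_eq (i + N) n) mulSn.
  have := ltn_pmod (i + N) n0; lia.
by rewrite modnMDl modn_small.
Qed.

Section Blocks.
Context {K : realType} {n : nat} {r_ : 'I_n -> nat}.
Local Notation E := (Pi K r_).
Local Notation C := (coPi K r_).

Lemma trPi_mul {p} i (M : 'M[K]_(\sum_j r_ j, p)) : (E i)^T *m M = submxcol M i.
Proof. by rewrite /Pi tr_submxrow trmx1 submxcol_mul mul1mx. Qed.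

Lemma coPi_tr i : (C i)^T = C i.
Proof. by rewrite /coPi trmxB trmx1 trmx_mul trmxK. Qed.

Lemma trPi_coPi i : (E i)^T *m C i = 0.
Proof. by rewrite mulmxBr mulmx1 mulmxA trPi_Pi mul1mx subrr. Qed.

Lemma trPi_coPi_neq i j : j != i -> (E j)^T *m C i = (E j)^T.
Proof.
move=> ji; rewrite mulmxBr mulmx1 mulmxA trPi_mul.
by rewrite (Pi_block K r_ i).2 // mul0mx subr0.
Qed.

Lemma Pi_coPi {p} i (F : 'M[K]_(_, p)) : E i *m ((E i)^T *m F) + C i *m F = F.
Proof. by rewrite mulmxA -mulmxDl addrC subrK mul1mx. Qed.

(** This is the only way in which the block structure of [R] enters. *)
Lemma block_diag_Pi i (R : 'M[K]_(\sum_j r_ j)) : block_diag R ->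
  R *m E i = E i *m subR R i.
Proof.
move=> [D RD]; have RE : R *m E i = E i *m D i.
  rewrite -[in LHS](submxcolK (E i)) RD mul_mxdiag_mxcol.
  rewrite -[RHS]submxcolK; apply/eq_mxcolP => j; rewrite -submxcol_mul.
  have [->|ji] := eqVneq j i; first by rewrite (Pi_block K r_ i).1 mulmx1 mul1mx.
  by rewrite (Pi_block K r_ i).2 // mulmx0 mul0mx.
by rewrite /subR -mulmxA RE (mulmxA (E i)^T) trPi_Pi mul1mx.
Qed.

Lemma posdef_subR i (R : 'M[K]_(\sum_j r_ j)) : sym_posdef R -> sym_posdef (subR R i).
Proof.
move=> [Rs R0]; split=> [|v v0]; first by rewrite /subR !trmx_mul trmxK Rs mulmxA.
rewrite /subR -qform_mulmx; apply: R0; apply: contra v0 => /eqP Ev.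
by rewrite -[v]mul1mx -(trPi_Pi K r_ i) -mulmxA Ev mulmx0.
Qed.

End Blocks.

Section SplitStep.
Context {K : realType} {n m : nat} {r_ : 'I_n -> nat}.
Context {A : 'M[K]_m} {B : 'M[K]_(m, \sum_j r_ j)}.
Context {Q : 'M[K]_m} {R : 'M[K]_(\sum_j r_ j)}.
Hypotheses (hQ : sym_posdef Q) (hR : sym_posdef R) (hRd : block_diag R).
Local Notation E := (Pi K r_).
Local Notation C := (coPi K r_).
Implicit Types (F : 'M[K]_(\sum_j r_ j, m)) (P : 'M[K]_m).

Lemma posdef_subQ i F : sym_posdef (subQ Q R i F).
Proof.
have E0 : F^T *m C i *m R *m C i *m F = (C i *m F)^T *m R *m (C i *m F).
  by rewrite trmx_mul coPi_tr !mulmxA.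
split=> [|v v0]; rewrite /subQ E0.
  by rewrite trmxD !trmx_mul !trmxK hQ.1 hR.1 coPi_tr !mulmxA.
by rewrite qformD -qform_mulmx ltr_wpDr ?posdef_ge0 //; exact: hQ.2.
Qed.

(** Since [R] does not couple block [i] with the others, the subproblem is the
    global problem with the other block rows of the feedback frozen. *)
Lemma sub_resid i F (H : 'M[K]_(r_ i, m)) P :
  resid (subA A B i F) (subB B i) (subQ Q R i F) (subR R i) H P =
  resid A B Q R (E i *m H + C i *m F) P.
Proof.
rewrite /resid; congr (lyap _ _ + _).
  by rewrite /subA /subB mulmxDr !mulmxA -addrA [X in A + X]addrC.
have ERC : (E i)^T *m R *m C i = 0.
  rewrite -[R]trmxK hR.1 -trmx_mul block_diag_Pi // trmx_mul.
  by rewrite -mulmxA trPi_coPi mulmx0.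
have CRE : C i *m R *m E i = 0.
  by apply: trmx_inj; rewrite !trmx_mul coPi_tr hR.1 mulmxA ERC trmx0.
rewrite /subQ -addrA; congr (_ + _).
rewrite trmxD !trmx_mul coPi_tr; move: (C i) ERC CRE => c ERC CRE.
rewrite !(mulmxDl, mulmxDr) !mulmxA.
have -> : H^T *m (E i)^T *m R *m c *m F = 0.
  by rewrite -!mulmxA (mulmxA (E i)^T) (mulmxA _ c) ERC mul0mx mulmx0.
have -> : F^T *m c *m R *m E i *m H = 0.
  by rewrite -!mulmxA (mulmxA c) (mulmxA _ (E i)) CRE mul0mx mulmx0.
by rewrite addr0 add0r addrC.
Qed.

Lemma trPi_gain i P :
  (E i)^T *m gain B R P = gain (subB B i) (subR R i) P.
Proof.
rewrite /gain mulmxN; congr (- _); rewrite !mulmxA; congr (_ *m P).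
rewrite /subB trmx_mul !mulmxA; congr (_ *m B^T).
have uR := posdef_unit _ hR; have uD := posdef_unit _ (posdef_subR i _ hR).
have ER : (E i)^T *m R = subR R i *m (E i)^T.
  by rewrite -[LHS]trmxK trmx_mul trmxK hR.1 block_diag_Pi // trmx_mul
    (posdef_subR i _ hR).1.
by rewrite -[in RHS](mulmxK uR (E i)^T) ER -mulmxA mulKmx.
Qed.

(** One step of the iteration: the new feedback is evaluated by the solution
    [P] of the subproblem, and the old one costs at least [P]. *)
Lemma split_step i F : (exists H, lyap_stable (subA A B i F + subB B i *m H)) ->
  let P := riccati (subA A B i F) (subB B i) (subQ Q R i F) (subR R i) in
  let F' := update A B Q R i F in
  [/\ exists! P, sub_riccati_sol A B Q R i F P,
      sym_posdef P /\ resid A B Q R F' P = 0,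
      lyap_stable (A + B *m F'),
      forall v, 0 <= qform (resid A B Q R F P) v &
      (E i)^T *m F' = (E i)^T *m gain B R P /\ C i *m F' = C i *m F].
Proof.
move=> [H sH] P F'; have pQ := posdef_subQ i F; have pR := posdef_subR i _ hR.
have ex := riccati_exists_unique pQ pR _ sH.
have sP : sub_riccati_sol A B Q R i F P.
  have [P0 [sP0 _]] := ex.
  by apply: (getPex (P := [set P | sub_riccati_sol A B Q R i F P])); exists P0.
have rP : resid A B Q R F' P = 0.
  by have [_] := (riccati_solE pR _).1 sP; rewrite sub_resid.
have F'E := (updateP A B Q R i F F').1 (erefl _).
split=> //; first by split=> //; exact: sP.1.
- by apply: (resid_lyap_stable hQ hR F' P) => [|v]; [exact: sP.1|rewrite rP qform0].
- by move=> v; rewrite -(Pi_coPi i F) -sub_resid; exact: riccati_resid_ge0.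
- by rewrite trPi_gain.
Qed.

Section Iteration.
Variables (F0 : 'M[K]_(\sum_j r_ j, m)) (i : 'I_n).
Hypothesis stabilizable : exists H, lyap_stable (subA A B i F0 + subB B i *m H).
Let F := split_opi A B Q R F0 i.
Let P k := riccati (subA A B (sweep i k) (F k)) (subB B (sweep i k))
  (subQ Q R (sweep i k) (F k)) (subR R (sweep i k)).

(** A stabilizing feedback stabilizes the subproblem through its own blocks, so
    the hypothesis on the first subproblem propagates to all the others. *)
Lemma split_stabilizable k :
  exists H, lyap_stable (subA A B (sweep i k) (F k) + subB B (sweep i k) *m H).
Proof.
elim: k => [//|k IH]; exists ((E (sweep i k.+1))^T *m F k.+1).
have [_ _ sF _ _] := split_step _ _ IH.
suff -> : forall j G, subA A B j G + subB B j *m ((E j)^T *m G) = A + B *m G by [].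
move=> j G; rewrite -{3}(Pi_coPi j G) mulmxDr /subA /subB !mulmxA.
by rewrite -addrA; congr (_ + _); rewrite addrC.
Qed.

Lemma split_iterates k :
  [/\ exists! P, sub_riccati_sol A B Q R (sweep i k) (F k) P,
      sym_posdef (P k) /\ resid A B Q R (F k.+1) (P k) = 0,
      lyap_stable (A + B *m F k.+1),
      forall v, 0 <= qform (resid A B Q R (F k) (P k)) v &
      (E (sweep i k))^T *m F k.+1 = (E (sweep i k))^T *m gain B R (P k) /\
      C (sweep i k) *m F k.+1 = C (sweep i k) *m F k].
Proof. exact: split_step (split_stabilizable k). Qed.

(** [P k] is the cost form of the feedback [F k.+1], and [P k.+1] is a lower
    bound for the cost of that same feedback. *)
Lemma split_P_noninc k v : qform (P k.+1) v <= qform (P k) v.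
Proof.
have [_ [pP rP] sF _ _] := split_iterates k.
have [_ [pP' _] _ geP' _] := split_iterates k.+1.
apply: (@resid_le _ _ _ A B Q R (F k.+1)) => //; [exact: pP'.1|exact: pP.1|move=> w].
by rewrite rP qform0; exact: geP'.
Qed.

(** The solutions of the subproblems decrease to some [L]. Each block row of
    the iterates is reset to that of the gain of the current solution whenever
    the sweep visits it, so the iterates converge to the gain of [L]; as a limit
    of policy iteration [L] then solves the Riccati equation. *)
Lemma split_cvg : F k @[k --> \oo] --> lqr_gain A B Q R.
Proof.
have [L PL [Ls L0]] : exists2 L, P k @[k --> \oo] --> (L : 'M[K]_m) &
    L^T = L /\ forall v, 0 <= qform L v.
  have pP k : sym_posdef (P k) by have [_ []] := split_iterates k.
  apply: psd_monotone_cvg => k; [exact: (pP k).1|by move=> v; exact: posdef_ge0|].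
  exact: split_P_noninc.
have block j : (E j)^T *m F k @[k --> \oo] --> (E j)^T *m gain B R L.
  apply: (cvg_sampled _ (fun k => (E j)^T *m gain B R (P k))).
  - by apply: cvg_mulmx; [exact: cvg_cst|exact: cvg_gain].
  - move=> k; have [_ _ _ _ [EF CF]] := split_iterates k.
    have [->|jk] := eqVneq j (sweep i k); [by left|right].
    by rewrite -(trPi_coPi_neq _ _ jk) -!mulmxA CF.
  - move=> N; have [k Nk <-] := sweep_often _ i j N; exists k => //.
    by have [_ _ _ _ [EF _]] := split_iterates k.
have FL : F k @[k --> \oo] --> gain B R L.
  apply: cvg_mx => x y.
  have entry (M : 'M[K]_(\sum_j r_ j, m)) :
      M x y = ((E (tagnat.sig1 x))^T *m M) (tagnat.sig2 x) y.
    by rewrite trPi_mul -{1}(submxcolK M) mxE.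
  by rewrite entry (funext (fun k => entry (F k))); exact: cvg_entry.
have sL : riccati_sol A B Q R L.
  apply: (policy_limit hQ hR (fun k => F k.+1) P) => //.
    by move=> k; have [_ []] := split_iterates k.
  by move: FL; rewrite -cvg_shiftS.
suff E : riccati A B Q R = L by rewrite /lqr_gain E.
apply: (riccati_unique hQ hR); last exact: sL.
by apply: (getPex (P := [set P | riccati_sol A B Q R P])); exists L.
Qed.

End Iteration.
End SplitStep.

(** * Derivatives of matrices, and controllability *)

Section MatrixDerivatives.
Context {K : realType}.
Implicit Types t : K.

Lemma is_derive_mxP {m n} (f : K -> 'M[K]_(m, n)) (d : 'M[K]_(m, n)) t :
  is_derive t (1 : K) f d <->
  forall i j, is_derive t (1 : K) (fun s => f s i j) (d i j).
Proof.
split=> [fd i j|fd].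
  have df : derivable f t 1 by [].
  apply: DeriveDef; first exact: (derivable_mxP f t 1).1.
  by rewrite -[d](@derive_val _ _ _ _ _ _ _ fd) derive_mx // mxE.
have df : derivable f t 1 by apply/derivable_mxP => i j.
apply: DeriveDef => //; rewrite derive_mx //; apply/matrixP => i j.
by rewrite mxE derive_val.
Qed.

Lemma is_derive_mulmx {m n p} (f : K -> 'M[K]_(m, n)) (g : K -> 'M[K]_(n, p))
    (df : 'M[K]_(m, n)) (dg : 'M[K]_(n, p)) t :
  is_derive t (1 : K) f df -> is_derive t (1 : K) g dg ->
  is_derive t (1 : K) (fun s => f s *m g s) (df *m g t + f t *m dg).
Proof.
move=> /is_derive_mxP fd /is_derive_mxP gd; apply/is_derive_mxP => i j.
have -> : (fun s => (f s *m g s) i j) = \sum_k ((fun s => f s i k) * (fun s => g s k j)).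
  by apply/funext => s; rewrite mxE fct_sumE.
have fg k := is_deriveM (fd i k) (gd k j).
apply: (is_derive_eq (is_derive_sum fg)); rewrite !mxE -big_split.
by apply: eq_bigr => k _; rewrite addrC [df i k * _]mulrC.
Qed.

Lemma is_derive_cstmx {m n} (M : 'M[K]_(m, n)) t : is_derive t (1 : K) (fun=> M) 0.
Proof. exact: is_derive_cst. Qed.

Lemma is_derive_trmx {m n} (f : K -> 'M[K]_(m, n)) (d : 'M[K]_(m, n)) t :
  is_derive t (1 : K) f d -> is_derive t (1 : K) (fun s => (f s)^T) d^T.
Proof.
move=> /is_derive_mxP fd; apply/is_derive_mxP => i j; rewrite mxE.
by rewrite (_ : (fun s => (f s)^T i j) = (fun s => f s j i)) //;
  apply/funext => s; rewrite mxE.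
Qed.

Lemma is_derive_mulmxr {m n p} (M : 'M[K]_(m, n)) (f : K -> 'M[K]_(n, p))
    (d : 'M[K]_(n, p)) t :
  is_derive t (1 : K) f d -> is_derive t (1 : K) (fun s => M *m f s) (M *m d).
Proof.
move=> fd; apply: (is_derive_eq (is_derive_mulmx _ _ _ _ _ (is_derive_cstmx M t) fd)).
by rewrite mul0mx add0r.
Qed.

Lemma is_derive_qform {m} (P M : 'M[K]_m) (x : K -> 'cV[K]_m) t :
  is_derive t (1 : K) x (M *m x t) ->
  is_derive t (1 : K) (fun s => qform P (x s)) (qform (lyap M P) (x t)).
Proof.
move=> dx; have := is_derive_mulmx _ _ _ _ _ (is_derive_trmx _ _ _ dx)
  (is_derive_mulmxr P _ _ _ dx).
move=> /is_derive_mxP/(_ 0 0).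
rewrite trmx_mul /qform /lyap mulmxDr mulmxDl !mulmxA.
by under eq_fun do rewrite mulmxA.
Qed.

Lemma within_continuous_mulmxr {m n} (M : 'M[K]_(m, n)) (S : set K) (x : K -> 'cV[K]_n) :
  {within S, continuous x} -> {within S, continuous (fun t => M *m x t)}.
Proof.
move=> cx t; have ft := nbhs_filter t.
have cM : M @[_ --> t] --> M by apply: cvg_cst.
exact (@cvg_mulmx _ _ _ ft _ _ _ _ _ _ _ cM (cx t)).
Qed.

Lemma within_continuous_qform {m} (P : 'M[K]_m) (S : set K) (x : K -> 'cV[K]_m) :
  {within S, continuous x} -> {within S, continuous (fun t => qform P (x t))}.
Proof.
move=> cx t; have ft := nbhs_filter t.
have cP : P @[_ --> t] --> P by apply: cvg_cst.
exact (@cvg_qform _ _ _ ft _ _ _ _ _ cP (cx t)).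
Qed.

End MatrixDerivatives.

(** The square norm of a solution satisfies [h' <= c h], so [h] times
    [exp (- c t)] does not increase from its initial value [0]. *)
Lemma linear_ode_zero {K : realType} {p} (M : 'M[K]_p) (y : K -> 'cV[K]_p) (T : K) :
  0 < T -> {within `[0, T], continuous y} ->
  (forall t, 0 < t < T -> is_derive t (1 : K) y (M *m y t)) ->
  y 0 = 0 -> y T = 0.
Proof.
move=> T0 cy dy y0.
have [c c0 Mc] := posdef_dominates (lyap M 1%:M) 1%:M posdef1.
pose h t := qform 1%:M (y t) * expR (- c * t).
have dh t : 0 < t < T ->
    is_derive t (1 : K) h
      ((qform (lyap M 1%:M) (y t) - c * qform 1%:M (y t)) * expR (- c * t)).
  move=> /dy/(is_derive_qform 1%:M) dq.
  have de : is_derive t (1 : K) (fun s => expR (- c * s)) (- c * expR (- c * t)).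
    have di : is_derive t (1 : K) (fun s => - c * s) (- c * 1) by exact: is_deriveZ.
    have := is_derive1_comp (is_derive_expR (- c * t)) di.
    by rewrite mulr1 mulrC.
  apply: (is_derive_eq (is_deriveM dq de)); rewrite /= /GRing.scale /=; ring.
have ch : {within `[0, T], continuous h}.
  have c1 := within_continuous_qform 1%:M _ _ cy.
  have c2 : {within `[0, T], continuous (fun t => expR (- c * t))}.
    apply: continuous_subspaceT => t; apply: continuous_comp; last exact: continuous_expR.
    by apply: cvgMr; exact: cvg_id.
  by move=> t; apply: cvgM; [exact: c1|exact: c2].
have hT0 : h T <= h 0.
  apply: (@ler0_derive1_le_cc _ h 0 T) => //; last exact: ltW.
  - by move=> t; rewrite in_itv /= => /dh dht; exact: ex_derive.
  - move=> t; rewrite in_itv /= => /dh dht; rewrite derive1E derive_val.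
    by rewrite mulr_le0_ge0 ?expR_ge0 // subr_le0.
  - by rewrite in_itv /= lexx ltW.
  - by rewrite in_itv /= lexx ltW.
apply/eqP; apply: contraT => /posdef1.2 yT.
move: hT0; rewrite /h y0 qform0v mul0r; have := expR_gt0 (- c * T); nra.
Qed.

(** The kernel of [N] contains the range of [B] and is invariant under [A], so a
    trajectory that starts at the origin never leaves it. *)
Lemma controllable_full {K : realType} {m r} (A : 'M[K]_m) (B : 'M[K]_(m, r))
    (N M : 'M[K]_m) :
  controllable A B -> N *m B = 0 -> N *m A = M *m N -> N = 0.
Proof.
move=> cAB NB NA; apply/matrixP => i j.
have [T [u [x [T0 _ [cx dx] x0 xT]]]] := cAB 0 (delta_mx j 0).
have : N *m x T = 0.
  apply: (linear_ode_zero M (fun t => N *m x t) T T0).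
  - exact: within_continuous_mulmxr.
  - move=> t tT; apply: (is_derive_eq (is_derive_mulmxr N x _ t (dx t _))).
      by rewrite interior_itv /= in_itv.
    by rewrite mulmxDr !mulmxA NB mul0mx addr0 NA.
  - by rewrite x0 mulmx0.
by rewrite xT -colE => /colP/(_ i); rewrite !mxE.
Qed.

(** Bass's construction. For [b] large, [- (A + b I)] is stable, so there is a
    symmetric [Z] with [(A + b I) Z + Z (A + b I)^T = 2 B B^T], and [Z] is
    nonnegative. Its kernel is invariant under [A^T] and killed by [B^T], so it
    is trivial by controllability. With the feedback [- B^T Z^-1] the closed
    loop [M] then satisfies [M Z + Z M^T = - 2 b Z]. *)
Lemma controllable_stabilizable {K : realType} {m r} (A : 'M[K]_m) (B : 'M[K]_(m, r)) :
  controllable A B -> exists H, lyap_stable (A + B *m H).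
Proof.
move=> cAB; have [c c0 Ac] := posdef_dominates (- (A + A^T)) 1%:M posdef1.
pose N := - (A + c%:M)^T.
have NE X : lyap N X = - ((A + c%:M) *m X + X *m (A + c%:M)^T).
  by rewrite /lyap /N trmxN trmxK mulNmx mulmxN -opprD.
have sN : lyap_stable N.
  exists 1%:M => [|v v0]; first exact: posdef1.
  have -> : lyap N 1%:M = - (A + A^T) - (c *+ 2) *: 1%:M.
    rewrite NE mulmx1 mul1mx trmxD tr_scalar_mx addrACA opprD.
    by rewrite -[c%:M]scalemx1 -scalerDl mulr2n.
  rewrite qformB qformZ; have := Ac v; have := posdef1.2 v v0; nra.
have BBs : (- ((B *m B^T) *+ 2))^T = - ((B *m B^T) *+ 2).
  by rewrite trmxN mulr2n trmxD trmx_mul trmxK.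
have [Z Zs ZN] := lyap_solve _ _ sN BBs.
have ZE : (A + c%:M) *m Z + Z *m (A + c%:M)^T = (B *m B^T) *+ 2.
  by apply: oppr_inj; rewrite -NE.
have qBB v : qform (B *m B^T) v = qform 1%:M (B^T *m v).
  by rewrite qform_mulmx trmxK mulmx1.
have Z0 : forall v, 0 <= qform Z v.
  apply: (lyap_compare N) => // v; rewrite ZN qformN mulr2n qformD qBB.
  have := posdef_ge0 (B^T *m v) posdef1; lra.
have pZ : sym_posdef Z.
  have kerZ (v : 'cV[K]_m) : Z *m v = 0 -> B^T *m v = 0 /\ Z *m (A^T *m v) = 0.
    move=> Zv; have vZ : v^T *m Z = 0 by rewrite -[Z]trmxK Zs -trmx_mul Zv trmx0.
    have Bv : B^T *m v = 0.
      apply/eqP; apply: contraT => /posdef1.2; rewrite -qBB.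
      have : qform ((A + c%:M) *m Z + Z *m (A + c%:M)^T) v = 0.
        rewrite qformD {2}/qform (mulmxA v^T) vZ !mul0mx mxE addr0.
        by rewrite /qform -!mulmxA Zv !mulmx0 mxE.
      by rewrite ZE mulr2n qformD; lra.
    split=> //; have := congr1 (mulmx^~ v) ZE; rewrite mulmxDl -!mulmxA Zv mulmx0.
    rewrite add0r trmxD tr_scalar_mx !mulmxDl mulmxDr mul_scalar_mx -scalemxAr Zv.
    by rewrite scaler0 addr0 -!mulmxA Bv mulmx0 addr0.
  have : kermx Z = 0.
    have kerP : kermx Z *m Z = 0 by exact: mulmx_ker.
    have row_ker i : Z *m (row i (kermx Z))^T = 0.
      by rewrite -{1}Zs -trmx_mul -row_mul kerP row0 trmx0.
    have [M NA] : exists M, kermx Z *m A = M *m kermx Z.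
      apply/submxP; rewrite sub_kermx; apply/eqP/row_matrixP => i.
      rewrite -mulmxA row_mul row0; apply: trmx_inj.
      by rewrite !trmx_mul Zs trmx0 -mulmxA; have [] := kerZ _ (row_ker i).
    apply: (controllable_full A B _ M cAB) => //; apply/row_matrixP => i.
    rewrite row_mul row0; apply: trmx_inj; rewrite trmx_mul trmx0.
    by have [] := kerZ _ (row_ker i).
  move=> /eqP; rewrite kermx_eq0 row_free_unit => uZ.
  split=> // v v0; rewrite lt_neqAle Z0 andbT; apply: contra v0 => /eqP/esym qv.
  by rewrite -[v](mulKmx uZ) (psd_null Z v Zs Z0 qv) mulmx0.
exists (- (B^T *m invmx Z)); rewrite -[_ + _]trmxK; apply: lyap_stable_tr.
exists Z => // v v0; have uZ := posdef_unit _ pZ.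
suff -> : lyap (A + B *m - (B^T *m invmx Z))^T Z = - ((c *+ 2) *: Z).
  by rewrite qformN qformZ oppr_lt0 mulr_gt0 ?pZ.2 // pmulrn_lgt0.
rewrite /lyap trmxK mulmxN !trmxD trmxN !trmx_mul !trmxK posdef_inv_tr //.
rewrite mulmxBl mulmxBr !mulmxA mulmxKV // mulmxV // mul1mx.
move: ZE; rewrite trmxD tr_scalar_mx mulmxDl mulmxDr mul_scalar_mx mul_mx_scalar.
move: (A *m Z) (Z *m A^T) (B *m B^T) => X Y W /matrixP E.
by apply/matrixP => i j; move: (E i j); rewrite !mulr2n !mxE; lra.
Qed.

(** * Closed-loop trajectories and their cost *)

Section LinearODE.
Context {K : realType} {m : nat}.
Variable M : 'M[K]_m.
Implicit Types (v : 'cV[K]_m) (t : K).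

Definition exp_mx_coeff (i : 'I_m) v : K^nat :=
  fun k => iter k (mulmx M) v i 0 / k`!%:R.

(** Differentiating a power series shifts its coefficients, which for the
    coordinates of [exp (t M) v] amounts to replacing [v] by [M v]. *)
Lemma exp_mx_coeff_diffs i v :
  pseries_diffs (exp_mx_coeff i v) = exp_mx_coeff i (M *m v).
Proof.
apply/funext => k; rewrite /pseries_diffs /exp_mx_coeff -iterSr factS natrM.
by rewrite invfM mulrCA [_.+1%:R * _]mulrA mulfV ?mul1r // pnatr_eq0.
Qed.

(** The Euclidean norm of [M ^ k v] grows at most geometrically, so the
    series is dominated by an exponential series. *)
Lemma is_cvg_exp_mx i v t : cvgn (pseries (exp_mx_coeff i v) t).
Proof.
have [c c0 Mc] := posdef_dominates (M^T *m M) 1%:M posdef1.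
have growth k : qform 1%:M (iter k (mulmx M) v) <= c ^+ k * qform 1%:M v.
  elim: k => [|k IH]; first by rewrite expr0 mul1r.
  rewrite iterS qform_mulmx mulmx1 (le_trans (Mc _)) // exprS -mulrA.
  by rewrite ler_pM2l.
have entry (u : 'cV[K]_m) : `|u i 0| <= Num.sqrt (qform 1%:M u).
  rewrite -sqrtr_sqr ler_wsqrtr // qform1E (bigD1 i) //= lerDl.
  by rewrite sumr_ge0 // => j _; exact: sqr_ge0.
pose b := Num.sqrt (qform 1%:M v); pose a := Num.sqrt c * `|t|.
apply: normed_cvg; apply: (@series_le_cvg _ _ (fun k => b * exp_coeff a k)) => [k|k|k|].
- exact: normr_ge0.
- by rewrite mulr_ge0 ?sqrtr_ge0 // exp_coeff_ge0 // mulr_ge0 ?sqrtr_ge0.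
- rewrite /exp_mx_coeff /exp_coeff /= !normrM normfV normrX normr_nat.
  rewrite /a exprMn mulrAC !mulrA ler_wpM2r ?invr_ge0 ?ler0n //.
  rewrite ler_wpM2r ?exprn_ge0 // (le_trans (entry _)) //.
  have -> : Num.sqrt c ^+ k = Num.sqrt (c ^+ k).
    by rewrite -{2}(sqr_sqrtr (ltW c0)) -exprM mulnC exprM sqrtr_sqr ger0_norm //
      exprn_ge0 // sqrtr_ge0.
  by rewrite /b mulrC -sqrtrM ?exprn_ge0 ?(ltW c0) // ler_wsqrtr // growth.
- rewrite [X in cvgn X](_ : _ = b *: series (exp_coeff a)); last first.
    by apply/funext => n; rewrite /series /= -mulr_sumr.
  by apply: is_cvgZr; exact: is_cvg_series_exp_coeff.
Qed.

(** The vector [exp (t M) v]. *)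
Definition exp_mx v t : 'cV[K]_m := \col_i limn (pseries (exp_mx_coeff i v) t).

Lemma exp_mx_mulmx v t : exp_mx (M *m v) t = M *m exp_mx v t.
Proof.
apply/colP => i; rewrite !mxE; apply: cvg_lim => //.
under eq_bigr do rewrite mxE.
have -> : pseries (exp_mx_coeff i (M *m v)) t =
    (fun n => \sum_j M i j * pseries (exp_mx_coeff j v) t n).
  apply/funext => n; rewrite /pseries /series /=.
  under [RHS]eq_bigr do rewrite mulr_sumr.
  rewrite exchange_big; apply: eq_bigr => k _.
  rewrite /exp_mx_coeff -iterSr iterS mxE !mulr_suml; apply: eq_bigr => j _.
  by rewrite !mulrA.
apply: cvg_big => [|j _]; first exact: add_continuous.
by apply: cvgMr; exact: is_cvg_exp_mx.
Qed.

Lemma is_derive_exp_mx v t : is_derive t (1 : K) (exp_mx v) (M *m exp_mx v t).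
Proof.
rewrite -exp_mx_mulmx; apply/is_derive_mxP => i j; rewrite ord1.
have -> : (fun s => exp_mx v s i 0) = (fun s => limn (pseries (exp_mx_coeff i v) s)).
  by apply/funext => s; rewrite mxE.
rewrite mxE -exp_mx_coeff_diffs; apply: (@pseries_snd_diffs _ _ (`|t| + 1));
  rewrite ?exp_mx_coeff_diffs; try exact: is_cvg_exp_mx.
by rewrite [ltRHS]ger0_norm ?addr_ge0 // ltrDl.
Qed.

Lemma exp_mx0 v : exp_mx v 0 = v.
Proof.
apply/colP => i; rewrite mxE; apply: lim_near_cst => //.
exists 1%N => // -[//|n] _; rewrite /pseries /series /= big_nat_recl //.
rewrite big1 ?addr0 => [|k _]; last by rewrite expr0n mulr0.
by rewrite /exp_mx_coeff /= fact0 divr1 mulr1.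
Qed.

End LinearODE.

Lemma closed_loopP {K : realType} {m r} (A : 'M[K]_m) (B : 'M[K]_(m, r))
    (F : 'M[K]_(r, m)) x0 (x := closed_loop A B F x0) :
  [/\ {within `[0, +oo[, continuous x},
      forall t : K, 0 < t -> is_derive t (1 : K) x ((A + B *m F) *m x t) & x 0 = x0].
Proof.
have : exists x, trajectory A B `[0, +oo[ (fun t => F *m x t) x /\ x 0 = x0.
  exists (exp_mx (A + B *m F) x0); split; last exact: exp_mx0.
  split=> [|t _]; last by rewrite mulmxA -mulmxDl; exact: is_derive_exp_mx.
  apply: derivable_within_continuous => t _.
  by have ? := is_derive_exp_mx (A + B *m F) x0 t.
move=> /(getPex (P := [set x | trajectory A B `[0, +oo[ (fun t => F *m x t) x /\ x 0 = x0])).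
move=> [[cx dx] ?]; split=> // t t0; rewrite mulmxDl -mulmxA; apply: dx.
by rewrite interior_itv /= in_itv /= t0.
Qed.

Section Dissipation.
Context {K : realType} {m : nat}.
Variables (M : 'M[K]_m) (x : K -> 'cV[K]_m).
Hypothesis cx : {within `[0, +oo[, continuous x}.
Hypothesis dx : forall t : K, 0 < t -> is_derive t (1 : K) x (M *m x t).
Local Notation mu := (@lebesgue_measure K).

Lemma continuous_segment (T : K) : {within `[0, T], continuous x}.
Proof. by apply: continuous_subspaceW cx; exact: subset_itvl. Qed.

(** The integrand is the derivative of [- P] along the trajectory. *)
Lemma integral_lyap (P : 'M[K]_m) (T : K) : 0 < T ->
  (\int[mu]_(t in `[0%R, T]) (qform (- lyap M P)%R (x t))%:E =
   (qform P (x 0%R) - qform P (x T))%:E)%E.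
Proof.
move=> T0; pose h t := qform (- P) (x t).
have dh (t : K) : 0 < t -> is_derive t (1 : K) h (qform (- lyap M P) (x t)).
  move=> /dx/(is_derive_qform (- P)); rewrite /lyap mulmxN mulNmx -opprD; exact.
have ch := within_continuous_qform (- P) _ _ (continuous_segment T).
have [_ h0 hT] := (continuous_within_itvP _ T0).1 ch.
rewrite (@continuous_FTC2 _ _ h) //.
- by rewrite -EFinB /h !qformN opprK addrC.
- exact: within_continuous_qform (continuous_segment T).
- by split=> // t; rewrite in_itv /= => /andP[/dh ? _].
- by move=> t; rewrite in_itv /= => /andP[/dh ? _]; rewrite derive1E derive_val.
Qed.

Lemma integrable_qform (S : 'M[K]_m) (T : K) :
  mu.-integrable `[0, T] (EFin \o (fun t => qform S (x t))).
Proof.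
apply: continuous_compact_integrable; first exact: segment_compact.
exact: within_continuous_qform (continuous_segment T).
Qed.

End Dissipation.

Section Value.
Context {K : realType} {m r : nat}.
Context {A : 'M[K]_m} {B : 'M[K]_(m, r)} {Q : 'M[K]_m} {R : 'M[K]_r}.
Hypotheses (hQ : sym_posdef Q) (hR : sym_posdef R).
Implicit Types (F : 'M[K]_(r, m)) (P : 'M[K]_m) (v : 'cV[K]_m).
Local Notation mu := (@lebesgue_measure K).

Lemma running_cost_ge0 F v : 0 <= qform (Q + F^T *m R *m F) v.
Proof. by rewrite qformD -qform_mulmx addr_ge0 ?posdef_ge0. Qed.

Lemma valueE F v : value A B Q R F v = (\int[mu]_(t in `[0%R, +oo[)
  (qform (Q + F^T *m R *m F)%R (closed_loop A B F v t))%:E)%E.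
Proof. by apply: eq_integral => t _; rewrite qformD -qform_mulmx. Qed.

Lemma resid_lyapN F P :
  resid A B Q R F P = Q + F^T *m R *m F - (- lyap (A + B *m F) P).
Proof. by rewrite opprK addrC. Qed.

(** The cost up to time [T] is [P[v] - P[x T]], where [x] is the closed-loop
    trajectory from [v], and the last term is nonnegative. *)
Lemma value_le F P v : (forall w, 0 <= qform P w) ->
  resid A B Q R F P = 0 -> (value A B Q R F v <= (qform P v)%:E)%E.
Proof.
move=> P0; rewrite resid_lyapN => /eqP; rewrite subr_eq0 => /eqP E.
rewrite valueE; have [cx dx x0] := closed_loopP A B F v.
set x := closed_loop A B F v in cx dx x0 *.
pose S (n : nat) : set (measurableTypeR K) := `[0%R, n.+1%:R : K]%classic.
rewrite itv0y_bigcup0S.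
have S_nd : nondecreasing_seq S.
  apply/nondecreasing_seqP => n; rewrite subsetEset; apply: subset_itvl.
  by rewrite bnd_simp ler_nat.
have mS n : measurable (S n) by exact: measurable_itv.
have cvgS : (\int[mu]_(t in S n) (qform (Q + F^T *m R *m F)%R (x t))%:E)%E @[n --> \oo]
    --> (\int[mu]_(t in \bigcup_n S n) (qform (Q + F^T *m R *m F)%R (x t))%:E)%E.
  apply: (@ge0_nondecreasing_set_cvg_integral _ (measurableTypeR K)) => //.
    move=> n; set S' := Q + F^T *m R *m F.
    by have /integrableP[] := integrable_qform _ cx S' n.+1%:R.
  by move=> n t _; rewrite lee_fin running_cost_ge0.
rewrite -(cvg_lim _ cvgS) //; apply: lime_le; last apply: nearW => n.
  by apply/cvg_ex; eexists; exact: cvgS.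
by rewrite E integral_lyap ?ltr0n // x0 lee_fin gerBl.
Qed.

(** If the cost [J] were below [P[v]], the inequality [P[v] - P[x T] <= J] would
    keep [P[x T]], hence also the running cost, bounded away from [0], and the
    cost would be infinite. *)
Lemma value_ge F P v : sym_posdef P ->
  (forall w, 0 <= qform (resid A B Q R F P) w) ->
  ((qform P v)%:E <= value A B Q R F v)%E.
Proof.
move=> pP FP; rewrite valueE; have [cx dx x0] := closed_loopP A B F v.
set x := closed_loop A B F v in cx dx x0 *.
set S := Q + F^T *m R *m F; pose g t := qform S (x t).
have g0 t : 0 <= g t by exact: running_cost_ge0.
have intg T : mu.-integrable `[0, T] (EFin \o g) by exact: integrable_qform.
have mg : measurable_fun `[0 : K, +oo[ g.
  apply: subspace_continuous_measurable_fun => //.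
  exact: within_continuous_qform.
have subJ T : (\int[mu]_(t in `[0%R, T]) (g t)%:E <= \int[mu]_(t in `[0%R, +oo[) (g t)%:E)%E.
  apply: ge0_subset_integral => //; first exact/measurable_EFinP.
    by move=> t _; rewrite lee_fin.
  exact: subset_itvl.
rewrite leNgt; apply/negP => J_lt.
have [J JE] : exists J, (\int[mu]_(t in `[0%R, +oo[) (g t)%:E)%E = J%:E.
  exists (fine (\int[mu]_(t in `[0%R, +oo[) (g t)%:E)); rewrite fineK //.
  rewrite ge0_fin_numE ?(lt_trans J_lt) ?ltey //.
  by apply: integral_ge0 => t _; rewrite lee_fin.
rewrite JE lte_fin in J_lt; pose e := qform P v - J.
have e0 : 0 < e by rewrite subr_gt0.
have far T : 0 <= T -> e <= qform P (x T).
  rewrite le_eqVlt => /predU1P[<-|T0].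
    have : (0 <= J%:E)%E by rewrite -JE; apply: integral_ge0 => t _; rewrite lee_fin.
    by rewrite x0 lee_fin /e; lra.
  have : (\int[mu]_(t in `[0%R, T]) (qform (- lyap (A + B *m F) P)%R (x t))%:E <= J%:E)%E.
    rewrite -JE; apply: le_trans (subJ T); apply: le_integral => //.
      exact: integrable_qform.
    move=> t _; rewrite lee_fin; have := FP (x t).
    by rewrite resid_lyapN qformB -/S /g; lra.
  by rewrite integral_lyap // x0 lee_fin /e; lra.
have [c c0 PS] : exists2 c, 0 < c & forall w, qform P w <= c * qform S w.
  have [c c0 PQ] := posdef_dominates P Q hQ; exists c => // w.
  rewrite (le_trans (PQ w)) // ler_pM2l // qformD -qform_mulmx lerDl.
  exact: posdef_ge0.
have g_far t : 0 <= t -> e / c <= g t.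
  by move=> t0; rewrite ler_pdivrMr // mulrC (le_trans (far t t0)) // mulrC PS.
have JT (T : K) : 0 < T -> e / c * T <= J.
  move=> T0; rewrite -lee_fin -JE; apply: le_trans (subJ T).
  have -> : (e / c * T)%:E = (\int[mu]_(t in `[0%R, T]) (cst (e / c)%:E t))%E.
    rewrite integral_cst //= lebesgue_measure_itv /= lte_fin T0 -EFinD subr0.
    by rewrite EFinM.
  apply: ge0_le_integral => //.
  - by move=> t _; rewrite lee_fin divr_ge0 // ltW.
  - by have /integrableP[] := intg T.
  - by move=> t /=; rewrite in_itv /= => /andP[t0 _]; rewrite lee_fin g_far.
have ec0 : 0 < e / c by rewrite divr_gt0.
have T0 : 0 < (`|J| + 1) / (e / c) by rewrite divr_gt0 // ltr_wpDl.
have := JT _ T0; rewrite mulrCA mulfV ?gt_eqF //.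
by have := ler_norm J; lra.
Qed.

End Value.

Theorem theorem1 (K : realType) (n : nat) (m_ r_ : 'I_n -> nat)
    (A : 'M[K]_(\sum_j m_ j)) (B : 'M[K]_(\sum_j m_ j, \sum_j r_ j))
    (Q : 'M[K]_(\sum_j m_ j)) (R : 'M[K]_(\sum_j r_ j))
    (hQ : sym_posdef Q) (hQd : block_diag Q)
    (hR : sym_posdef R) (hRd : block_diag R)
    (F0 : 'M[K]_(\sum_j r_ j, \sum_j m_ j)) (i : 'I_n)
    (hc : controllable (subA A B i F0) (subB B i)) :
  let F := split_opi A B Q R F0 i in
  (* the iteration and the optimal feedback are well defined *)
  (forall k : nat, exists! P, sub_riccati_sol A B Q R (sweep i k) (F k) P) /\
  (exists! P, riccati_sol A B Q R P) /\
  (* (i) *)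
  (forall k : nat, (1 <= k)%N -> stable (A + B *m F k)) /\
  (* (ii) *)
  (forall (k : nat) (x : 'cV[K]_(\sum_j m_ j)),
     (value A B Q R (F k.+1) x <= value A B Q R (F k) x)%E) /\
  (* (iii) *)
  F k @[k --> \oo] --> lqr_gain A B Q R.
Proof.
have it := split_iterates hQ hR hRd F0 i (controllable_stabilizable _ _ hc).
split=> [k|]; first by have [] := it k.
split; first by have [_ _ sF _ _] := it 0; exact: riccati_exists_unique sF.
split=> [[//|k] _|]; first by apply: lyap_stable_stable; have [] := it k.
split=> [k x|]; last exact: split_cvg (controllable_stabilizable _ _ hc).
have [_ [pP rP] _ geP _] := it k.
apply: le_trans (value_ge hQ hR _ _ x pP geP).
by apply: value_le => // v; exact: posdef_ge0.
Qed.
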